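(* Let $A=k[x_1,\dots,x_n]/(x_1^{d_1},\dots,x_n^{d_n})$ be a monomial complete intersection over a field $k$ of characteristic zero and let $\ell=x_1+\cdots+x_n$. Let $e=\sum_{j=1}^n(d_j-1)$ denote the socle degree of $A$, $\mathbf{d}=(d_1,\dots,d_n)$ and $\mathbf{d}'=(d_1,\dots,d_{n-1})$. Denote by $a_{n,i,\mathbf{d}}$ the absolute value of the determinant of $$\cdot\ell^t:A_i\to A_{e-i}$$ for $t=e-2i$. Then, for any $i\leq e/2$ (with $i\ge 0$ an integer and $t=e-2i$), we have $$a_{n,i,\mathbf{d}}=\left(\prod_{j=\max\{0,d_n-t\}}^{\min\{i,d_n-1\}}a_{n-1,i-j,\mathbf{d}'}\right)\prod_{s=\max\{1,d_n-i-1\}}^{\min\{t-1,d_n-1\}}|\det(C_{t,s,d_n})|^{h_{i+s-(d_n-1)}-h_{i+s-d_n}},$$ where $h_j=\dim_k\bigl(k[x_1,\dots,x_{n-1}]/(x_1^{d_1},\dots,x_{n-1}^{d_{n-1}})\bigr)_j$. In particular, $a_{n,i,\mathbf{d}}\neq 0$ and $A$ has the strong Lefschetz property.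
   Context: $n\ge1$ and $d_1,\dots,d_n\geq 1$ are integers; $A_j$ is the degree $j$ component of $A$ in the standard grading. Determinants are taken with respect to the monomial bases of $A_i$ and $A_{e-i}$ (consisting of the nonzero residue classes of monomials), so that they are integers, well defined up to sign. Similarly $a_{n-1,i',\mathbf{d}'}$ is the absolute value of the determinant of multiplication by $(x_1+\cdots+x_{n-1})^{e'-2i'}$ from degree $i'$ to degree $e'-i'$ on $B=k[x_1,\dots,x_{n-1}]/(x_1^{d_1},\dots,x_{n-1}^{d_{n-1}})$, where $e'=\sum_{j=1}^{n-1}(d_j-1)$. ($B=k$ if $n=1$.) Also $h_j=0$ when $j<0$ or $j>e'$, and empty products are $1$. For integers $t,p,d$, $C_{t,p,d}$ is the $(d-p)\times(d-p)$ matrix whose entry in row $a$ and column $b$ is $\binom{t}{d+1-a-b}$, with $\binom{t}{j}=0$ if $j<0$ or $j>t$; so its first row is $\binom{t}{d-1},\binom{t}{d-2},\dots,\binom{t}{p}$ and its last row is $\binom{t}{p},\binom{t}{p-1},\dots,\binom{t}{2p-(d-1)}$. A standard graded artinian algebra $A$ has the strong Lefschetz property (SLP) if there is $\ell\in A_1$ such that $\cdot\ell^t:A_i\to A_{i+t}$ is injective or surjective for all $i\ge0$, $t\geq 1$. *)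

(* Defs.v *)
From HB Require Import structures.
From mathcomp Require Import all_boot all_order all_algebra all_field.
From mathcomp Require Import generic_quotient ring_quotient.
From mathcomp Require Import boolp.
From mathcomp Require Import mpoly.

Set Implicit Arguments.
Unset Strict Implicit.
Unset Printing Implicit Defensive.

Import GRing.Theory.

Local Open Scope ring_scope.
Local Open Scope quotient_scope.

Definition monomials (n i : nat) : seq 'X_{1..n} :=
  [seq bmnm m | m <- enum {: 'X_{1..n < i.+1}} & mdeg (bmnm m) == i].

Lemma mem_monomials n i (m : 'X_{1..n}) : (m \in monomials n i) = (mdeg m == i).
Proof.
apply/mapP/eqP => [[m']|<-]; first by rewrite mem_filter => /andP[/eqP mi _] ->.
by exists (BMultinom (ltnSn (mdeg m))); rewrite // mem_filter mem_enum /= eqxx.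
Qed.

Lemma monomials_uniq n i : uniq (monomials n i).
Proof.
rewrite map_inj_uniq; last by move=> m1 m2; apply: val_inj.
exact/filter_uniq/enum_uniq.
Qed.

Definition socdeg n (d : 'I_n -> nat) : nat := (\sum_j (d j - 1))%N.

Section Ideal.
Variables (k : fieldType) (n : nat) (d : 'I_n -> nat).
Implicit Types (p q : {mpoly k[n]}) (m : 'X_{1..n}).

(* The ideal (x_1^{d_1}, ..., x_n^{d_n}). *)
Definition ci_ideal : {pred {mpoly k[n]}} :=
  fun p => `[< exists c : 'I_n -> {mpoly k[n]}, p = \sum_j c j * 'X_j ^+ d j >].

(* Exponents of the monomials that survive in the quotient, see mclX_eq0. *)
Definition small m := [forall j, m j < d j]%N.

Lemma ci_idealP p :
  reflect (exists c : 'I_n -> {mpoly k[n]}, p = \sum_j c j * 'X_j ^+ d j)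
          (p \in ci_ideal).
Proof. exact: asboolP. Qed.

Lemma ci_ideal_lin a : {in ci_ideal &, forall u v, a * u + v \in ci_ideal}.
Proof.
move=> u v /ci_idealP[c ->] /ci_idealP[c' ->]; apply/ci_idealP.
exists (fun j => a * c j + c' j); rewrite mulr_sumr -big_split /=.
by apply: eq_bigr => j _; rewrite mulrDl mulrA.
Qed.

Lemma ci_ideal0 : 0 \in ci_ideal.
Proof.
by apply/ci_idealP; exists (fun=> 0); rewrite big1 // => j _; rewrite mul0r.
Qed.

Lemma ci_ideal_coef p m : p \in ci_ideal -> small m -> p@_m = 0.
Proof.
case/ci_idealP=> c -> /forallP sm; rewrite raddf_sum /= big1 // => j _.
rewrite mpolyXn mcoeffM big1 // => -[m1 m2] /= /eqP mE.
rewrite mcoeffX; case: eqP => [m2E|_]; last by rewrite mulr0.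
have mjE : m j = (bmnm m1 j + d j)%N.
  by rewrite [in LHS]mE -m2E mnmDE mulmnE mnm1E eqxx mul1n.
by have := sm j; rewrite mjE ltnNge leq_addl.
Qed.

Lemma ci_ideal_mon m : ~~ small m -> 'X_[m] \in ci_ideal.
Proof.
rewrite negb_forall => /existsP[j]; rewrite -leqNgt => le_dm.
apply/ci_idealP.
exists (fun i => if i == j then 'X_[(m - U_(j) *+ d j)%MM] else 0).
rewrite (bigD1 j) //= eqxx big1 ?addr0 => [|i /negPf ->]; last by rewrite mul0r.
rewrite mpolyXn -mpolyXD submK //; apply/mnm_lepP => i.
rewrite mulmnE mnm1E; case: eqP => [<-|_]; first by rewrite mul1n.
by rewrite mul0n.
Qed.

Lemma ci_idealE p : reflect (forall m, small m -> p@_m = 0) (p \in ci_ideal).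
Proof.
apply: (iffP idP) => [pI m|p0]; first exact: ci_ideal_coef.
rewrite (mpolyE p); elim/big_rec: _ => [|m q _ qI]; first exact: ci_ideal0.
have [/p0 ->|/ci_ideal_mon mI] := boolP (small m); first by rewrite scale0r add0r.
by rewrite -mul_mpolyC; apply: ci_ideal_lin.
Qed.

Hypothesis d_gt0 : forall j, (0 < d j)%N.

Lemma ci_ideal_closed : idealr_closed ci_ideal.
Proof.
split; [exact: ci_ideal0 | | exact: ci_ideal_lin].
apply/negP => /ci_idealE/(_ 0%MM); rewrite mcoeff1 eqxx => H.
have /H/eqP : small 0%MM by apply/forallP => j; rewrite mnm0E.
by rewrite oner_eq0.
Qed.

Definition ci_idealr : idealr {mpoly k[n]} :=
  HB.pack ci_ideal (isIdealr.Build _ ci_ideal ci_ideal_closed).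
(* k[x_1, ..., x_n]/(x_1^{d_1}, ..., x_n^{d_n}); positivity of the d_j is what
   makes the ideal proper. *)
Definition mci := {ideal_quot ci_idealr}.
HB.instance Definition _ := GRing.ComNzRing.on mci.

Definition mcl (p : {mpoly k[n]}) : mci := \pi p.
HB.instance Definition _ :=
  GRing.isZmodMorphism.Build {mpoly k[n]} mci mcl (pi_is_zmod_morphism mci).
HB.instance Definition _ :=
  GRing.isMonoidMorphism.Build {mpoly k[n]} mci mcl (pi_is_monoid_morphism mci).

Definition mci_scale (a : k) (x : mci) : mci := mcl a%:MP * x.
Fact mci_scalerA a b x : mci_scale a (mci_scale b x) = mci_scale (a * b) x.
Proof. by rewrite /mci_scale mulrA -rmorphM -mpolyCM. Qed.
Fact mci_scale1r : left_id 1 mci_scale.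
Proof. by move=> x; rewrite /mci_scale rmorph1 mul1r. Qed.
Fact mci_scalerDr : right_distributive mci_scale +%R.
Proof. by move=> a x y; rewrite /mci_scale mulrDr. Qed.
Fact mci_scalerDl x : {morph mci_scale^~ x : a b / a + b}.
Proof. by move=> a b; rewrite /mci_scale mpolyCD rmorphD mulrDl. Qed.
HB.instance Definition _ := GRing.Zmodule_isLmodule.Build k mci
  mci_scalerA mci_scale1r mci_scalerDr mci_scalerDl.
Fact mci_scalerAl (a : k) (x y : mci) : a *: (x * y) = (a *: x) * y.
Proof. exact: mulrA. Qed.
HB.instance Definition _ := GRing.Lmodule_isLalgebra.Build k mci mci_scalerAl.
HB.instance Definition _ := GRing.Lalgebra_isComAlgebra.Build k mci.

Fact mcl_scalable : scalable mcl.
Proof. by move=> a p; rewrite -mul_mpolyC rmorphM. Qed.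
HB.instance Definition _ :=
  GRing.isScalable.Build k {mpoly k[n]} mci *:%R mcl mcl_scalable.

Lemma mcl_surj x : {p | x = mcl p}.
Proof. by exists (repr x); rewrite /mcl reprK. Qed.

Lemma mcl_eq0 p : (mcl p == 0) = (p \in ci_ideal).
Proof. by rewrite -(rmorph0 mcl) -Quotient.idealrBE subr0. Qed.

Lemma mclX_eq0 m : (mcl 'X_[m] == 0) = ~~ small m.
Proof.
rewrite mcl_eq0; apply/idP/idP => [/ci_idealE/(_ m)|]; last exact: ci_ideal_mon.
by rewrite mcoeffX eqxx => H; apply/negP => /H/eqP; rewrite oner_eq0.
Qed.

Definition mcoef m (x : mci) : k := (repr x)@_m.

Lemma mcoef_mcl m p : small m -> mcoef m (mcl p) = p@_m.
Proof.
move=> sm; apply/eqP; rewrite -subr_eq0 -mcoeffB; apply/eqP.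
apply: ci_ideal_coef sm; rewrite -mcl_eq0 rmorphB /= /mcl reprK.
by rewrite subrr.
Qed.

Lemma mcoef_linear m a x y : small m ->
  mcoef m (a *: x + y) = a * mcoef m x + mcoef m y.
Proof.
move=> sm; have [[p ->] [q ->]] := (mcl_surj x, mcl_surj y).
by rewrite -linearP !mcoef_mcl // mcoeffD mcoeffZ.
Qed.

Lemma mcoef_sum m I (r : seq I) (F : I -> mci) : small m ->
  mcoef m (\sum_(i <- r) F i) = \sum_(i <- r) mcoef m (F i).
Proof.
move=> sm; elim/big_rec2: _ => [|i x y _ IH].
  by rewrite -(rmorph0 mcl) mcoef_mcl // mcoeff0.
by rewrite -[F i]scale1r mcoef_linear // mul1r IH scale1r.
Qed.

Lemma mcoef_inj x y : (forall m, small m -> mcoef m x = mcoef m y) -> x = y.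
Proof.
have [[p ->] [q ->]] := (mcl_surj x, mcl_surj y) => H.
apply/eqP; rewrite -subr_eq0 -rmorphB mcl_eq0; apply/ci_idealE => m sm.
by have := H m sm; rewrite !mcoef_mcl // mcoeffB => ->; rewrite subrr.
Qed.

Lemma small_mdeg m : small m -> (mdeg m < (socdeg d).+1)%N.
Proof.
move/forallP => sm; rewrite ltnS mdegE leq_sum // => j _.
by have := sm j; case: (d j) => // x; rewrite ltnS subn1.
Qed.

Let smalls := [pred m : 'X_{1..n < (socdeg d).+1} | small m].

Definition mci_row (x : mci) : 'rV[k]_#|smalls| :=
  \row_c mcoef (enum_val c : 'X_{1..n < (socdeg d).+1}) x.

Fact mci_vect_axiom : Vector.axiom #|smalls| mci.
Proof.
have smP (c : 'I_#|smalls|) : small (bmnm (enum_val c)) := enum_valP c.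
exists mci_row => [a x y|].
  by apply/rowP => c; rewrite !mxE mcoef_linear //; apply: smP.
exists (fun v : 'rV_#|smalls| =>
          \sum_c v 0 c *: mcl 'X_[bmnm (enum_val c)]) => [x|v].
  apply: mcoef_inj => m sm; rewrite mcoef_sum //.
  pose m' : 'X_{1..n < (socdeg d).+1} := BMultinom (small_mdeg sm).
  have m's : m' \in smalls by [].
  rewrite (bigD1 (enum_rank_in m's m')) //= -linearZ mcoef_mcl // mxE.
  rewrite enum_rankK_in //= mcoeffZ mcoeffX eqxx mulr1 big1 ?addr0 // => c ne_c.
  rewrite -linearZ mcoef_mcl // mcoeffZ mcoeffX; case: eqP => [mE|]; last first.
    by rewrite mulr0.
  case/eqP: ne_c; apply: enum_val_inj; rewrite enum_rankK_in //.
  exact: val_inj.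
apply/rowP => c; rewrite mxE mcoef_sum // (bigD1 c) //= big1 ?addr0.
  by rewrite -linearZ mcoef_mcl // mcoeffZ mcoeffX eqxx mulr1.
move=> c' ne_c; rewrite -linearZ mcoef_mcl // mcoeffZ mcoeffX.
case: eqP => [/val_inj/enum_val_inj cE|]; last by rewrite mulr0.
by rewrite cE eqxx in ne_c.
Qed.
HB.instance Definition _ := Lmodule_hasFinDim.Build k mci mci_vect_axiom.
HB.instance Definition _ := Algebra_isFalgebra.Build k mci.

End Ideal.

Section Grading.
Variables (k : fieldType) (n : nat) (d : 'I_n -> nat).
Hypothesis d_gt0 : forall j, (0 < d j)%N.
Local Notation A := (mci k d_gt0).
Local Notation mcl := (@mcl k n d d_gt0).

Definition mci_comp (i : nat) : {vspace A} :=
  <<[seq mcl 'X_[m] | m <- monomials n i]>>%VS.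

Definition mci_basis (i : nat) : seq A :=
  [seq x <- [seq mcl 'X_[m] | m <- monomials n i] | x != 0].

Definition mci_ell : A := \sum_j mcl 'X_j.

Lemma mci_compP i x :
  reflect (exists2 p : {mpoly k[n]}, p \is i.-homog & x = mcl p)
          (x \in mci_comp i).
Proof.
apply: (iffP idP) => [|[p /dhomogP ph ->]].
  move/(@coord_span _ _ _ (in_tuple _)) => ->.
  exists (\sum_c coord (in_tuple [seq mcl 'X_[m] | m <- monomials n i]) c x *:
           'X_[nth 0%MM (monomials n i) c]).
    apply: rpred_sum => c _; apply: rpredZ; rewrite dhomogX.
    rewrite -mem_monomials mem_nth //.
    by have := ltn_ord c; rewrite [X in (_ < X)%N]size_map.
  rewrite linear_sum; apply: eq_bigr => c _; rewrite linearZ /=.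
  rewrite (nth_map 0%MM) //.
  by have := ltn_ord c; rewrite [X in (_ < X)%N]size_map.
rewrite (mpolyE p) linear_sum /= big_seq; apply: memv_suml => m /ph mi.
rewrite linearZ memvZ //; apply/memv_span/map_f.
by rewrite mem_monomials mi.
Qed.

Lemma mci_basisE i :
  mci_basis i = [seq mcl 'X_[m] | m <- monomials n i & small d m].
Proof.
rewrite /mci_basis filter_map; congr map; apply: eq_filter => m /=.
by rewrite mclX_eq0 negbK.
Qed.

Lemma mci_basisP i : basis_of (mci_comp i) (mci_basis i).
Proof.
rewrite /basis_of; apply/andP; split.
  rewrite eqEsubv; apply/andP; split; apply/span_subvP => x.
    by rewrite mem_filter => /andP[_ /memv_span].
  move=> xM; have [->|x0] := eqVneq x 0; first exact: mem0v.
  by apply: memv_span; rewrite mem_filter x0.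
rewrite mci_basisE; set s := [seq m <- _ | _].
have s_uniq : uniq s by rewrite filter_uniq ?monomials_uniq.
apply/(@freeP _ _ _ (in_tuple _)) => c c0 i0.
have lt_s (j : 'I_(size [seq mcl 'X_[m] | m <- s])) : (j < size s)%N.
  by have := ltn_ord j; rewrite [X in (_ < X)%N]size_map.
have s_small j : (j < size s)%N -> small d (nth 0%MM s j).
  by move/(mem_nth 0%MM); rewrite mem_filter => /andP[].
have sm := s_small _ (lt_s i0).
have := congr1 (mcoef (nth 0%MM s i0)) c0.
rewrite mcoef_sum // -(rmorph0 mcl) mcoef_mcl // mcoeff0 (bigD1 i0) //=.
rewrite big1 ?addr0 => [|j ne_j].
  by rewrite (nth_map 0%MM) // -linearZ mcoef_mcl // mcoeffZ mcoeffX eqxx mulr1.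
rewrite (nth_map 0%MM) // -linearZ mcoef_mcl // mcoeffZ mcoeffX.
by rewrite nth_uniq // (inj_eq val_inj) (negPf ne_j) mulr0.
Qed.

Lemma size_mci_basis i : (i <= socdeg d)%N ->
  size (mci_basis (socdeg d - i)) = size (mci_basis i).
Proof.
pose co (m : 'X_{1..n}) : 'X_{1..n} := [multinom (d j - 1 - m j)%N | j < n].
have co_small m : small d (co m).
  by apply/forallP => j; rewrite mnmE -subnDA ltn_subrL d_gt0.
have coK m : small d m -> co (co m) = m.
  move/forallP => sm; apply/mnmP => j; rewrite !mnmE subKn //.
  by rewrite -ltnS subn1 prednK.
have co_deg m : small d m -> mdeg (co m) = (socdeg d - mdeg m)%N.
  move/forallP => sm; rewrite !mdegE -sumnB => [|j _].
    by apply: eq_bigr => j _; rewrite mnmE.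
  by rewrite -ltnS subn1 prednK.
have le_size a b : (a <= socdeg d)%N -> b = (socdeg d - a)%N ->
    (size (mci_basis a) <= size (mci_basis b))%N.
  move=> le_a ->; rewrite !mci_basisE !size_map.
  rewrite -[X in (X <= _)%N](size_map co).
  apply: uniq_leq_size.
    rewrite map_inj_in_uniq ?filter_uniq ?monomials_uniq // => m m'.
    rewrite !mem_filter => /andP[sm _] /andP[sm' _] /(congr1 co).
    by rewrite !coK.
  move=> _ /mapP[m + ->]; rewrite !mem_filter !mem_monomials co_small /=.
  by case/andP=> sm /eqP <-; rewrite co_deg.
move=> le_i; apply/eqP; rewrite eqn_leq !le_size ?leq_subr //.
by rewrite subKn.
Qed.

(* Matrix of multiplication by ell^t from degree i to degree i + t in the
   monomial bases, acting on row vectors. *)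
Definition lef_mx (i t : nat) :
    'M[k]_(size (mci_basis i), size (mci_basis (i + t))) :=
  \matrix_(r, c)
    coord (in_tuple (mci_basis (i + t))) c (mci_ell ^+ t * (mci_basis i)`_r).

Lemma lef_mxP i t (r : 'I_(size (mci_basis i))) :
  mci_ell ^+ t * (mci_basis i)`_r =
  \sum_c lef_mx i t r c *: (mci_basis (i + t))`_c.
Proof.
have bE j := mci_basisP j.
have : mci_ell ^+ t * (mci_basis i)`_r \in mci_comp (i + t).
  have /mci_compP[p ph ->] : (mci_basis i)`_r \in mci_comp i.
    by apply: (basis_mem (bE i)); rewrite mem_nth.
  apply/mci_compP; exists ((\sum_j 'X_j) ^+ t * p).
    rewrite addnC; apply: dhomogM => //; rewrite -[t in t.-homog]mul1n.
    by apply/dhomogMn/rpred_sum => j _; rewrite dhomogX; apply/eqP/mdeg1.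
  by rewrite rmorphM rmorphXn rmorph_sum.
rewrite -(span_basis (bE _)).
move/(@coord_span _ _ _ (in_tuple (mci_basis (i + t)))) => {1}->.
by apply: eq_bigr => c _; rewrite mxE.
Qed.

Lemma lef_mx_int i t : exists Z, lef_mx i t = map_mx intr Z.
Proof.
pose sm j := [seq m <- monomials n j | small d m].
pose q m : {mpoly int[n]} := (\sum_j 'X_j) ^+ t * 'X_[m].
exists (\matrix_(r, c) (q (nth 0%MM (sm i) r))@_(nth 0%MM (sm (i + t)) c)).
apply/matrixP => r c; rewrite !mxE.
have lt_sm j (r' : 'I_(size (mci_basis j))) : (r' < size (sm j))%N.
  by rewrite -(size_map (fun m => mcl (mpolyX k m))) -mci_basisE.
have bE j (r' : 'I_(size (mci_basis j))) :
    (mci_basis j)`_r' = mcl 'X_[nth 0%MM (sm j) r'].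
  by rewrite [X in nth _ X _]mci_basisE (nth_map 0%MM) ?lt_sm.
have mc_small : small d (nth 0%MM (sm (i + t)) c).
  by have := mem_nth 0%MM (lt_sm _ c); rewrite mem_filter => /andP[].
have := congr1 (mcoef (nth 0%MM (sm (i + t)) c)) (lef_mxP t r).
rewrite mcoef_sum // (bigD1 c) //= big1 ?addr0 => [|c' ne_c]; last first.
  rewrite bE -linearZ mcoef_mcl // mcoeffZ mcoeffX.
  rewrite nth_uniq ?lt_sm ?filter_uniq ?monomials_uniq //.
  by rewrite (inj_eq val_inj) (negPf ne_c) mulr0.
rewrite [X in _ = mcoef _ (_ *: X)]bE -linearZ [RHS]mcoef_mcl // mcoeffZ mcoeffX.
rewrite eqxx mulr1 mxE => <-.
rewrite bE /mci_ell -rmorph_sum -rmorphXn -rmorphM mcoef_mcl //= -mcoeff_map_mpoly.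
congr mcoeff; rewrite rmorphM rmorphXn rmorph_sum /=; congr (_ ^+ _ * _).
  by apply: eq_bigr => j _; rewrite map_mpolyX.
by rewrite map_mpolyX.
Qed.

Lemma lef_mx_square i : (i.*2 <= socdeg d)%N ->
  size (mci_basis (i + (socdeg d - i.*2))) = size (mci_basis i).
Proof.
move=> le_2i; have le_i : (i <= socdeg d)%N.
  by apply: leq_trans le_2i; rewrite -addnn leq_addr.
rewrite -(size_mci_basis le_i) -addnn subnDA subnKC //.
by rewrite leq_subRL // addnn.
Qed.

(* The two bases have the same size when t = e - 2i (lef_mx_square), and then
   conform_mx only identifies the two dimensions; the zero matrix is a dummy for
   non-square cases. *)
Definition lef_det (i t : nat) : k :=
  \det (conform_mx (0 : 'M_(size (mci_basis i))) (lef_mx i t)).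

Lemma lef_det_int i t : exists N : nat,
  (lef_det i t == N%:R) || (lef_det i t == - N%:R).
Proof.
rewrite /lef_det; have [Z ->] := lef_mx_int i t.
have -> : conform_mx 0 (map_mx intr Z) =
    map_mx intr (conform_mx (0 : 'M_(size (mci_basis i))) Z) :> 'M[k]_ _.
  by rewrite map_conform_mx map_mx0.
rewrite det_map_mx; case: (\det _) => N; [exists N | exists N.+1].
  by apply/orP; left.
by apply/orP; right.
Qed.

(* lef_det is an element of k that is the image of an integer; this is the
   absolute value of that integer. When 2i <= e, the target degree
   i + (e - 2i) is e - i. In characteristic zero the value is the only one
   possible (lef_absdetP), so taking the least one is immaterial. *)
Definition lef_absdet (i : nat) : nat :=
  ex_minn (lef_det_int i (socdeg d - i.*2)).

Lemma lef_absdetP i (a : nat) : [pchar k] =i pred0 ->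
  reflect (lef_det i (socdeg d - i.*2) = a%:R \/
           lef_det i (socdeg d - i.*2) = - a%:R)
          (lef_absdet i == a).
Proof.
move=> /pcharf0P k0; rewrite /lef_absdet; case: ex_minnP => N NP _.
have natr_inj (x y : nat) : x%:R = y%:R :> k -> x = y.
  wlog le_xy : x y / (x <= y)%N => [W|].
    by case/orP: (leq_total x y) => le e; [|apply/esym]; apply: W.
  move/eqP; rewrite eq_sym -subr_eq0 -natrB // k0 subn_eq0 => le_yx.
  by apply/eqP; rewrite eqn_leq le_xy.
have natr_opp (x y : nat) : x%:R = - y%:R :> k -> x = y.
  move/eqP; rewrite -addr_eq0 -natrD k0 addn_eq0.
  by case/andP=> /eqP -> /eqP ->.
apply: (iffP eqP) => [<-|].
  by case/orP: NP => /eqP; [left | right].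
case/orP: NP => /eqP -> [] /eqP.
- by move/eqP/natr_inj.
- by move/eqP/natr_opp.
- by rewrite eq_sym => /eqP/natr_opp.
- by rewrite eqr_opp => /eqP/natr_inj.
Qed.

(* Indexed by int, with value 0 in negative degrees. *)
Definition hilb (j : int) : nat :=
  if j is Posz m then \dim (mci_comp m) else 0.

Lemma hilb_gt j : ((socdeg d)%:Z < j)%R -> hilb j = 0%N.
Proof.
case: j => // j lt_j; rewrite /hilb.
have /andP[/eqP <- /eqP ->] := mci_basisP j; rewrite mci_basisE size_map.
apply/eqP; rewrite size_eq0 -[_ == _]negbK -has_filter.
apply/hasPn => m; rewrite mem_monomials => /eqP mj; apply/negP => /small_mdeg.
by rewrite mj ltnS leqNgt -ltz_nat lt_j.
Qed.

End Grading.

Definition strong_Lefschetz (k : fieldType) (A : falgType k)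
    (A_ : nat -> {vspace A}) : Prop :=
  exists2 l : A, l \in A_ 1%N & forall i t : nat, (0 < t)%N ->
    {in A_ i &, injective (fun x => l ^+ t * x)} \/
    (forall y, y \in A_ (i + t)%N -> exists2 x, x \in A_ i & l ^+ t * x = y).

Definition binz (t : nat) (j : int) : int :=
  if j is Posz m then 'C(t, m)%:Z else 0.

(* The row and column indices a, b are 0-based, hence a.+1 and b.+1. *)
Definition Cmx (t p d : nat) : 'M[int]_(d - p) :=
  \matrix_(a, b) binz t (d%:Z + 1 - a.+1%:Z - b.+1%:Z).

Definition dinit n (d : 'I_n.+1 -> nat) : 'I_n -> nat :=
  fun j => d (widen_ord (leqnSn n) j).

Lemma dinit_gt0 n (d : 'I_n.+1 -> nat) :
  (forall j, 0 < d j)%N -> forall j, (0 < dinit d j)%N.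
Proof. by move=> d_gt0 j; apply: d_gt0. Qed.

(* Main.v *)
(* Let B = k[x_1, ..., x_(n-1)]/(x_1^d_1, ..., x_(n-1)^d_(n-1)). Pairing monomials
   with their complements, the determinant of l^(e-2i) on A_i is, up to sign, that of
   the Gram matrix of the form (f, f') |-> [x^(d-1)] l^(e - deg f - deg f') f f' on
   A_i = sum_c B_(i-c) x_n^c. Its block (c, c') is 'C(t, d_n - 1 - c - c') times the
   analogous form on B, and multiplication by powers of x_1 + ... + x_(n-1) lifts
   scalar row reductions of the binomial matrix to block row reductions. With q_N the
   leading N x N minor of the binomial matrix, the pivot at level c is therefore
   q_(c+1) / q_c times the form on B_(i-c), with determinant
   (q_(c+1) / q_c)^(h_(i-c)) a_(n-1,i-c); regrouping the powers of the q_c gives the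
   exponents h_(i-c) - h_(i-c-1). The reduction starts at c = max(0, d_n - t), below
   which the matrix is block antitriangular with identity blocks. The q_c do not
   vanish because a polynomial with at most N terms cannot be divisible by (X - a)^N,
   a != 0, in characteristic zero. *)
Require Import Defs.
From HB Require Import structures.
From mathcomp Require Import all_boot all_order all_algebra all_field.
From mathcomp Require Import perm mpoly.
From mathcomp Require Import zify ring.

Set Implicit Arguments.
Unset Strict Implicit.
Unset Printing Implicit Defensive.

Import Order.TTheory GRing.Theory Num.Theory.
Local Open Scope ring_scope.

(** * Determinants indexed by lists: Schur complements and triangular shapes *)

(** Giving the lower left block as a multiple of [A] avoids the inverse of [A], so any commutative
    ring will do. *)
Lemma det_block_schur (R : comNzRingType) n1 n2 (A : 'M[R]_n1) B D
    (X : 'M_(n2, n1)) :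
  \det (block_mx A B (X *m A) D) = \det A * \det (D - X *m B).
Proof.
have -> : block_mx A B (X *m A) D =
    block_mx 1%:M 0 X 1%:M *m block_mx A B 0 (D - X *m B).
  by rewrite mulmx_block !mul1mx !mul0mx !addr0 addrC subrK.
by rewrite det_mulmx det_lblock !det1 mul1r mul1r det_ublock.
Qed.

Section ListDeterminant.
Variables (T : eqType) (x0 : T).
Implicit Types (s : seq T).

Definition ldet (R : comNzRingType) s (f : T -> T -> R) : R :=
  \det (\matrix_(i < size s, j < size s) f (nth x0 s i) (nth x0 s j)).

Section ComRing.
Variable R : comNzRingType.
Implicit Types (f h : T -> T -> R).

Lemma ldet_size f n s : size s = n ->
  ldet s f = \det (\matrix_(i < n, j < n) f (nth x0 s i) (nth x0 s j)).
Proof. by case: n /. Qed.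

Lemma eq_ldet s f h : {in s &, f =2 h} -> ldet s f = ldet s h.
Proof.
by move=> fh; congr (\det _); apply/matrixP => i j; rewrite !mxE fh ?mem_nth.
Qed.

Lemma ldetZ s a f : ldet s (fun x y => a * f x y) = a ^+ size s * ldet s f.
Proof. by rewrite -detZ; congr (\det _); apply/matrixP => i j; rewrite !mxE. Qed.

(** [r] combines the rows of [s1] to match those of [s2] on the columns of [s1]; subtracting these
    combinations clears the lower left block. *)
Lemma ldet_cat s1 s2 f (r : T -> T -> R) :
    (forall x y, x \in s2 -> y \in s1 -> f x y = \sum_(z <- s1) r x z * f z y) ->
  ldet (s1 ++ s2) f =
    ldet s1 f * ldet s2 (fun x y => f x y - \sum_(z <- s1) r x z * f z y).
Proof.
move=> fr; rewrite (ldet_size _ (size_cat s1 s2)) /ldet.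
set D1 := \matrix_(_, _) _; set A := \matrix_(_, _) _; set S := \matrix_(_, _) _.
pose X := \matrix_(i < size s2, l < size s1) r (nth x0 s2 i) (nth x0 s1 l).
pose B := \matrix_(i < size s1, j < size s2) f (nth x0 s1 i) (nth x0 s2 j).
pose D := \matrix_(i < size s2, j < size s2) f (nth x0 s2 i) (nth x0 s2 j).
have -> : S = D - X *m B.
  apply/matrixP => i j; rewrite !mxE (big_nth x0) big_mkord; congr (_ - _).
  by apply: eq_bigr => l _; rewrite !mxE.
rewrite -det_block_schur; congr (\det _); apply/matrixP => i j.
rewrite mxE !nth_cat; case: (split_ordP i) => i' ->; case: (split_ordP j) => j' -> /=.
- by rewrite block_mxEul mxE.
- by rewrite addKn block_mxEur mxE.
- rewrite addKn block_mxEdl mxE fr ?mem_nth //.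
  by rewrite (big_nth x0) big_mkord; apply: eq_bigr => l _; rewrite !mxE.
- by rewrite !addKn block_mxEdr mxE.
Qed.

Lemma perm_nth_perm s s' : perm_eq s s' ->
  exists p : 'S_(size s), forall i : 'I_(size s), nth x0 s' i = nth x0 s (p i).
Proof.
rewrite perm_sym => /(@tuple_permP _ _ _ (in_tuple s))[p ->]; exists p => i.
by rewrite (nth_map i) -?enumT ?size_enum_ord // nth_ord_enum (tnth_nth x0).
Qed.

Lemma ldet_perm s s' f : perm_eq s s' -> ldet s f = ldet s' f.
Proof.
move=> ss'; rewrite (ldet_size f (esym (perm_size ss'))) /ldet.
have [p pE] := perm_nth_perm ss'; set A := \matrix_(_, _) _.
have -> : \matrix_(i < size s, j < size s) f (nth x0 s' i) (nth x0 s' j) =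
    row_perm p (col_perm p A) by apply/matrixP => i j; rewrite !mxE !pE.
rewrite row_permE col_permE !det_mulmx !det_perm odd_permV.
by rewrite mulrCA -signr_addb addbb mulr1.
Qed.

Lemma det_perm_col s s' f : perm_eq s s' ->
  exists b : bool,
    \det (\matrix_(i < size s, j < size s) f (nth x0 s i) (nth x0 s' j)) =
    (-1) ^+ b * ldet s f.
Proof.
move=> ss'; have [p pE] := perm_nth_perm ss'; exists p.
rewrite /ldet; set A := \matrix_(i, j) f _ (nth x0 s j).
have -> : \matrix_(i < size s, j < size s) f (nth x0 s i) (nth x0 s' j) =
    col_perm p A by apply/matrixP => i j; rewrite !mxE !pE.
by rewrite col_permE det_mulmx det_perm odd_permV mulrC.
Qed.

(** Sorting by [rho] makes the matrix lower triangular with unit diagonal. *)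
Lemma ldet_utrig s f (rho : T -> nat) : uniq s -> {in s, forall x, f x x = 1} ->
    {in s &, forall x y, x != y -> (rho x <= rho y)%N -> f x y = 0} ->
  ldet s f = 1.
Proof.
pose le := relpre rho leq.
have le_tot : total le by move=> x y; apply: leq_total.
have le_trans : transitive le by move=> x y z; apply: leq_trans.
have s_sort : perm_eq s (sort le s) by rewrite perm_sym perm_sort.
rewrite (ldet_perm f s_sort) (perm_uniq s_sort) => s_uniq f1 f0.
rewrite /ldet det_trig => [|]; last first.
  apply/is_trig_mxP => i j lt_ij; rewrite mxE f0 ?nth_uniq ?ltn_eqF //.
  - by rewrite (perm_mem s_sort) mem_nth.
  - by rewrite (perm_mem s_sort) mem_nth.
  apply: (@sorted_leq_nth _ le) => //; first by move=> x; apply: leqnn.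
  - exact: sort_sorted.
  - by rewrite inE.
  - by rewrite inE.
  - exact: ltnW.
by rewrite big1 // => i _; rewrite mxE f1 // (perm_mem s_sort) mem_nth.
Qed.

End ComRing.

Lemma rmorph_ldet (R R' : comNzRingType) (phi : {rmorphism R -> R'}) s f :
  phi (ldet s f) = ldet s (fun x y => phi (f x y)).
Proof. by rewrite -det_map_mx; congr (\det _); apply/matrixP => i j; rewrite !mxE. Qed.

(** Permuting the columns by the involution [sigma] reduces to [ldet_utrig], up to a sign. *)
Lemma norm_ldet_antitrig (R : numDomainType) s f (sigma : T -> T) (rho : T -> nat) :
    uniq s -> {in s, forall x, sigma x \in s} -> {in s, cancel sigma sigma} ->
    {in s, forall x, f x (sigma x) = 1} ->
    {in s &, forall x y, x != y -> (rho x <= rho y)%N -> f x (sigma y) = 0} ->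
  `|ldet s f| = 1 :> R.
Proof.
move=> s_uniq sigma_s sigmaK f1 f0.
have s_sigma : perm_eq s (map sigma s).
  apply: uniq_perm => // [|x].
    by rewrite map_inj_in_uniq //; apply: can_in_inj sigmaK.
  apply/idP/mapP => [xs|[y ys ->]]; last exact: sigma_s.
  by exists (sigma x); rewrite ?sigmaK ?sigma_s.
have [b] := det_perm_col f s_sigma.
set M := \det _; have -> : M = ldet s (fun x y => f x (sigma y)).
  by congr (\det _); apply/matrixP => i j; rewrite !mxE (nth_map x0).
rewrite (ldet_utrig s_uniq f1 f0) => /(congr1 Num.norm).
by rewrite normrMsign normr1.
Qed.

End ListDeterminant.

Lemma ldet_map (T T' : eqType) (x0 : T) (y0 : T') (R : comNzRingType)
    (phi : T -> T') s (f : T' -> T' -> R) :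
  ldet y0 (map phi s) f = ldet x0 s (fun x y => f (phi x) (phi y)).
Proof.
rewrite (ldet_size _ _ (size_map phi s)); congr (\det _).
by apply/matrixP => i j; rewrite !mxE !(nth_map x0).
Qed.

(** * Sparse polynomials with a root of high multiplicity *)

(* X p' - v p loses the term of degree v and only one factor X - a. *)
Lemma sparse_poly_eq0 (F : numFieldType) (S : seq nat) (p : {poly F}) a :
    a != 0 -> (forall i, p`_i != 0 -> i \in S) ->
  ('X - a%:P) ^+ size S %| p -> p = 0.
Proof.
move=> a0; elim: S p => [|v S IH] p pS.
  by move=> _; apply/polyP => i; rewrite coef0; apply/eqP/negPn/negP => /pS.
case/dvdpP => q pE; pose r := 'X * p^`() - v%:R *: p.
have rE i : r`_i = (i%:R - v%:R) * p`_i.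
  rewrite coefB coefZ coefXM coef_deriv; case: i => [|i] /=; first by ring.
  by rewrite -mulr_natl; ring.
have r0 : r = 0.
  apply: IH => [i|].
    rewrite rE mulf_eq0 negb_or subr_eq0 eqr_nat => /andP[iv /pS].
    by rewrite inE (negPf iv).
  have -> : r = ('X * (q^`() * ('X - a%:P) + q *+ (size S).+1)
      - v%:R *: (q * ('X - a%:P))) * ('X - a%:P) ^+ size S.
    rewrite /r pE derivM deriv_exp derivXsubC mul1r /= !exprS.
    rewrite -!mul_polyC -[q *+ _]mulr_natr -[_ ^+ _ *+ _]mulr_natr.
    by move: ('X - _) (v%:R%:P) (_.+1%:R) => u w w'; ring.
  exact: dvdp_mull.
have p_v i : i != v -> p`_i = 0.
  move=> iv; have /eqP := congr1 (fun u : {poly F} => u`_i) r0.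
  by rewrite rE coef0 mulf_eq0 subr_eq0 eqr_nat (negPf iv) => /eqP.
have pXv : p = p`_v *: 'X^v.
  apply/polyP => i; rewrite coefZ coefXn; have [->|/p_v ->] := eqVneq i v.
    by rewrite mulr1.
  by rewrite mulr0.
have /eqP : p.[a] = 0.
  by rewrite pE hornerM horner_exp hornerXsubC subrr expr0n mulr0.
rewrite pXv hornerZ hornerXn mulf_eq0 expf_eq0 (negPf a0) andbF orbF.
by move=> /eqP ->; rewrite scale0r.
Qed.

(** * Leading minors of the binomial matrix *)

(** The entries of [Cmx t p d] do not depend on [p]: for all [p] these matrices are leading blocks
    of one Hankel matrix. *)
Definition binom_hankel (t d a b : nat) : int :=
  binz t (d%:Z + 1 - a.+1%:Z - b.+1%:Z).

Lemma binom_hankelE t d a b : (a + b < d)%N ->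
  binom_hankel t d a b = 'C(t, d - 1 - a - b)%:Z.
Proof.
move=> lt_d; rewrite /binom_hankel.
by have -> : d%:Z + 1 - a.+1%:Z - b.+1%:Z = (d - 1 - a - b)%N by lia.
Qed.

Lemma binom_hankel0 t d a b : (d <= a + b)%N || (a + b + t + 1 < d)%N ->
  binom_hankel t d a b = 0.
Proof.
have [le_d _|lt_d] /= := leqP d (a + b); last first.
  by move=> lt_t; rewrite binom_hankelE // bin_small //; lia.
rewrite /binom_hankel; case E: (_ - _) => [m|//]; lia.
Qed.

Definition hankel_minor (t d N : nat) : int := ldet 0%N (iota 0 N) (binom_hankel t d).

Lemma det_Cmx t p d : \det (Cmx t p d) = hankel_minor t d (d - p).
Proof.
rewrite /hankel_minor (ldet_size _ _ (size_iota _ _)); congr (\det _).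
by apply/matrixP => a b; rewrite !mxE !nth_iota.
Qed.

(** A vector [v] in the left kernel gives a polynomial [c] of degree below [N] such that
    [(1 + X)^t c] has no terms in degrees [d - N] to [d - 1]. Its degree is below [N + t], so at
    most [t] terms remain, yet [(1 + X)^t] divides it: it is zero, and so is [v]. *)
Lemma hankel_minor_neq0 t d N : (N <= d)%N -> (d <= N + t)%N ->
  hankel_minor t d N != 0.
Proof.
move=> le_Nd le_dt; rewrite -(intr_eq0 rat) (rmorph_ldet _ intr).
rewrite (ldet_size _ _ (size_iota _ _)); apply/negP => /det0P[v v0 vM].
pose c : {poly rat} := \sum_(a < N) v 0 a *: 'X^a.
(* Exponents outside that gap; the bounds on [N] make their number exactly [t]. *)
pose S := iota 0 (d - N) ++ iota d (N + t - d).
have szS : size S = t by rewrite size_cat !size_iota; lia.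
have coef_1Xt j : ((1 + 'X) ^+ t : {poly rat})`_j = 'C(t, j)%:R.
  rewrite addrC exprD1n coef_sum; have [lt_j|le_j] := ltnP j t.+1.
    rewrite (bigD1 (Ordinal lt_j)) //= coefMn coefXn eqxx big1 ?addr0 // => i ij.
    rewrite coefMn coefXn; case: eqP => [ji|]; last by rewrite mul0rn.
    by case/eqP: ij; apply: val_inj.
  rewrite bin_small // big1 // => i _; rewrite coefMn coefXn gtn_eqF ?mul0rn //.
  exact: leq_trans le_j.
have coefF j : ((1 + 'X) ^+ t * c)`_j = 
    \sum_(a < N) v 0 a * (if (j < a)%N then 0 else 'C(t, j - a)%:R).
  rewrite mulr_sumr coef_sum; apply: eq_bigr => a _.
  by rewrite -scalerAr coefZ coefMXn coef_1Xt.
have F0 : (1 + 'X) ^+ t * c = 0.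
  apply: (@sparse_poly_eq0 rat S _ (-1)) => [||].
  - by rewrite oppr_eq0 oner_eq0.
  - move=> j; apply: contraNT; rewrite mem_cat !mem_iota negb_or => /andP[j1 j2].
    rewrite coefF; case: (ltnP j d) => jd.
      (* Column [d - 1 - j] of the matrix computes the coefficient of degree [j]. *)
      have lt_b : (d - 1 - j < N)%N by lia.
      have /eqP := congr1 (fun w : 'rV_N => w 0 (Ordinal lt_b)) vM.
      rewrite !mxE; congr (_ == _); apply: eq_bigr => a _; rewrite !mxE !nth_iota //= !add0n.
      congr (_ * _); case: ltnP => ja.
        by rewrite binom_hankel0 //; lia.
      by rewrite binom_hankelE; [congr ('C(_, _)%:R); lia | lia].
    rewrite big1 // => a _; have := ltn_ord a => lt_a.
    by rewrite ltnNge (leq_trans (ltnW lt_a)) ?bin_small ?mulr0 //=; lia.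
  by rewrite szS polyCN opprK addrC dvdp_mulr.
have c0 : c = 0.
  apply/eqP; move/eqP: F0; rewrite mulf_eq0 expf_eq0 => /orP[/andP[_]|//].
  by rewrite addrC -polyC1 -[_ + _ == _]size_poly_eq0 size_XaddC.
case/negP: v0; apply/eqP/rowP => a; rewrite mxE.
have := congr1 (fun u : {poly rat} => u`_a) c0; rewrite coef0 coef_sum (bigD1 a) //=.
rewrite coefZ coefXn eqxx mulr1 big1 ?addr0 // => b ba.
by rewrite coefZ coefXn eq_sym (inj_eq val_inj) (negPf ba) mulr0.
Qed.

(** At full size the antidiagonal entries are ['C(t, 0)] and the entries below it vanish. *)
Lemma norm_hankel_minor_top t d : `|hankel_minor t d d| = 1.
Proof.
apply: (@norm_ldet_antitrig _ _ _ _ _ (fun a => (d - 1 - a)%N) (fun a => (d - a)%N)).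
- exact: iota_uniq.
- by move=> a; rewrite !mem_iota; lia.
- by move=> a; rewrite mem_iota; lia.
- by move=> a; rewrite mem_iota => lt_a; rewrite binom_hankelE; [rewrite subnn bin0|lia].
- move=> a b; rewrite !mem_iota => lt_a lt_b ab le_ab; apply: binom_hankel0; lia.
Qed.

(** The antidiagonal entries are ['C(t, t)], and the entries above it are ['C(t, j)] with [j > t].
    For [d <= t] the minor is empty. *)
Lemma norm_hankel_minor_bottom t d : `|hankel_minor t d (d - t)| = 1.
Proof.
apply: (@norm_ldet_antitrig _ _ _ _ _ (fun a => (d - t - 1 - a)%N) id).
- exact: iota_uniq.
- by move=> a; rewrite !mem_iota; lia.
- by move=> a; rewrite mem_iota; lia.
- move=> a; rewrite mem_iota => lt_a; rewrite binom_hankelE; last lia.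
  by rewrite (_ : (_ - _)%N = t) ?binn; lia.
- move=> a b; rewrite !mem_iota => lt_a lt_b ab le_ab; apply: binom_hankel0; lia.
Qed.

(** [x] expresses row [N] through the preceding rows on the first [N] columns; subtracting that
    combination leaves the pivot in the corner. *)
Lemma hankel_minorS t d N : hankel_minor t d N != 0 ->
  exists2 x : nat -> rat,
    forall b, (b < N)%N -> (binom_hankel t d N b)%:~R =
       \sum_(c <- iota 0 N) x c * (binom_hankel t d c b)%:~R &
    (hankel_minor t d N)%:~R * ((binom_hankel t d N N)%:~R -
       \sum_(c <- iota 0 N) x c * (binom_hankel t d c N)%:~R) =
    (hankel_minor t d N.+1)%:~R :> rat.
Proof.
rewrite -(intr_eq0 rat) /hankel_minor !(rmorph_ldet _ intr).
pose Q a b : rat := (binom_hankel t d a b)%:~R.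
rewrite -/Q (ldet_size _ _ (size_iota 0 N)).
set M := \matrix_(_, _) _ => M0; have Mu : M \in unitmx by rewrite unitmxE unitfE.
pose v : 'rV[rat]_N := \row_b Q N b *m invmx M.
pose x c := if insub c is Some c' then v 0 c' else 0 : rat.
have xE b : (b < N)%N -> Q N b = \sum_(c <- iota 0 N) x c * Q c b.
  move=> lt_b.
  have := congr1 (fun w : 'rV_N => w 0 (Ordinal lt_b)) (mulmxKV Mu (\row_b Q N b)).
  rewrite -/v [LHS]mxE [RHS]mxE => <-; rewrite -[X in iota 0 X]subn0 big_mkord.
  by apply: eq_bigr => c _; rewrite /x valK [M _ _]mxE !nth_iota.
exists x => //.
rewrite -/M -(ldet_size 0%N Q (size_iota 0 N)) -[N.+1]addn1 iotaD.
rewrite (@ldet_cat _ _ _ _ _ _ (fun _ => x)) => [|a b].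
  congr (_ * _).
  by rewrite /ldet /= det_mx11 mxE.
by rewrite inE mem_iota => /eqP -> /andP[_]; apply: xE.
Qed.

(** * The Lefschetz form on monomials *)

Definition smonomials n (d : 'I_n -> nat) i : seq 'X_{1..n} :=
  [seq m <- monomials n i | small d m].

Definition sumX (R : nzRingType) n : {mpoly R[n]} := \sum_j 'X_j.

Definition socle n (d : 'I_n -> nat) : 'X_{1..n} := [multinom (d j - 1)%N | j < n].

(* The value of the Lefschetz form (f, f') |-> [x^(d-1)] l^(e-deg f-deg f') f f'
   on two monomials. *)
Definition gram n (d : 'I_n -> nat) (m m' : 'X_{1..n}) : int :=
  (sumX int n ^+ (socdeg d - mdeg m - mdeg m') * 'X_[m + m'])@_(socle d).

Lemma mcoeffMX_eq0 (R : comNzRingType) n (p : {mpoly R[n]}) (m k : 'X_{1..n}) :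
  ~~ (m <= k)%MM -> (p * 'X_[m])@_k = 0.
Proof.
move=> not_le; rewrite mcoeffM big1 // => -[m1 m2] /= /eqP kE.
rewrite mcoeffX; case: eqP => [m2E|_]; last by rewrite mulr0.
case/negP: not_le; rewrite kE m2E; apply/mnm_lepP => j.
by rewrite mnmDE leq_addl.
Qed.

Section Gram.
Variables (n : nat) (d : 'I_n -> nat).
Hypothesis d_gt0 : forall j, (0 < d j)%N.
Implicit Types m : 'X_{1..n}.

Lemma mem_smonomials i m : (m \in smonomials d i) = small d m && (mdeg m == i).
Proof. by rewrite mem_filter mem_monomials. Qed.

Lemma smonomials_uniq i : uniq (smonomials d i).
Proof. exact/filter_uniq/monomials_uniq. Qed.

Lemma smallE m : small d m = (m <= socle d)%MM.
Proof.
apply: eq_forallb => j; rewrite mnmE.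
by have := d_gt0 j; lia.
Qed.

Lemma mdeg_socle : mdeg (socle d) = socdeg d.
Proof. by rewrite mdegE; apply: eq_bigr => j _; rewrite mnmE. Qed.

Lemma small_compl m : small d (socle d - m)%MM.
Proof. by rewrite smallE; apply/mnm_lepP => j; rewrite mnmBE leq_subr. Qed.

Lemma complK m : small d m -> (socle d - (socle d - m) = m)%MM.
Proof.
rewrite smallE => /mnm_lepP le_m; apply/mnmP => j.
by rewrite !mnmBE subKn.
Qed.

Lemma mdeg_compl m : small d m -> mdeg (socle d - m)%MM = (socdeg d - mdeg m)%N.
Proof.
by rewrite smallE -mdeg_socle => /submK eq_m; rewrite -[in RHS]eq_m mdegD addnK.
Qed.

Lemma mdeg_small m : small d m -> (mdeg m <= socdeg d)%N.
Proof. exact: small_mdeg. Qed.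

Lemma sumX_homog (R : nzRingType) t : sumX R n ^+ t \is t.-homog.
Proof.
rewrite -[t in t.-homog]mul1n; apply/dhomogMn/rpred_sum => j _.
by rewrite dhomogX; apply/eqP/mdeg1.
Qed.

Lemma smonomials_compl i : (i <= socdeg d)%N ->
  perm_eq (smonomials d (socdeg d - i)) [seq (socle d - m)%MM | m <- smonomials d i].
Proof.
move=> le_i; apply: uniq_perm; first exact: smonomials_uniq.
  rewrite map_inj_in_uniq ?smonomials_uniq // => m m'; rewrite !mem_smonomials.
  by move=> /andP[sm _] /andP[sm' _] eq_co; rewrite -(complK sm) eq_co complK.
move=> m; rewrite mem_smonomials; apply/andP/mapP => [[sm /eqP mi]|[m' + ->]].
  exists (socle d - m)%MM; last by rewrite complK.
  by rewrite mem_smonomials small_compl mdeg_compl // mi subKn /=.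
rewrite mem_smonomials small_compl => /andP[sm /eqP mi].
by rewrite mdeg_compl // mi.
Qed.

(** Between degrees [i] and [e - i] the power of [l] is trivial, so the complements of the basis
    monomials form the dual basis. *)
Lemma gram_compl i m m' : m \in smonomials d i -> m' \in smonomials d i ->
  gram d m (socle d - m') = (m == m')%:R.
Proof.
rewrite !mem_smonomials => /andP[sm /eqP mi] /andP[sm' /eqP mi'].
rewrite /gram mdeg_compl // mi mi' subnn expr0 mul1r mcoeffX.
rewrite -{2}(submK (m := m') (m' := socle d)) -?smallE //.
by rewrite [(_ - _ + _)%MM]addmC eqm_add2r.
Qed.

(** Multiplying by ['X_[m']] moves the coefficient at the complement of [m'] to the socle; this
    makes entries of the multiplication matrix values of the form. *)
Lemma gram_coef t m m' : small d m' -> (t + mdeg m + mdeg m' = socdeg d)%N ->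
  (sumX int n ^+ t * 'X_[m])@_(socle d - m')%MM = gram d m m'.
Proof.
move=> sm' deg; rewrite /gram mpolyXD mulrA.
rewrite -[in RHS](submK (m := m') (m' := socle d)) -?smallE //.
rewrite [(_ - _ + _)%MM]addmC mcoeffMX; congr ((_ ^+ _ * _)@__); lia.
Qed.

(* Multiplying the first argument by l^q does not change the Lefschetz form. *)
Lemma gram_mul_sumX q i m m' : (mdeg m + q = i)%N -> (i + mdeg m' <= socdeg d)%N ->
  \sum_(z <- smonomials d i) (sumX int n ^+ q * 'X_[m])@_z * gram d z m' = gram d m m'.
Proof.
move=> mq le_e; set p := sumX int n ^+ q * 'X_[m].
have ph : p \is i.-homog.
  by rewrite -mq addnC; apply: dhomogM; rewrite ?sumX_homog ?dhomogX /=.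
pose s := (socdeg d - i - mdeg m')%N.
have -> : gram d m m' = (sumX int n ^+ s * 'X_[m'] * p)@_(socle d).
  rewrite /gram mpolyXD /p; congr (_@__).
  rewrite (_ : (socdeg d - mdeg m - mdeg m')%N = (s + q)%N); last by lia.
  by rewrite exprD; ring.
rewrite [in RHS](mpolyE p) mulr_sumr raddf_sum /=.
pose G z := p@_z * (sumX int n ^+ s * 'X_[m'] * 'X_[z])@_(socle d).
rewrite [RHS](eq_bigr G) => [|z _]; last by rewrite -scalerAr mcoeffZ.
rewrite [LHS](eq_big_seq G) => [|z]; last first.
  rewrite mem_smonomials => /andP[_ /eqP zi].
  by rewrite /G /gram zi -mulrA -mpolyXD addmC.
(* A monomial that is not small does not divide the socle monomial, so it contributes nothing. *)
rewrite [RHS](bigID (small d)) /= [X in _ + X]big1 ?addr0 => [|z sz]; last first.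
  by rewrite /G [X in _ * X]mcoeffMX_eq0 ?mulr0 // -smallE.
rewrite [LHS](bigID (mem (msupp p))) /= [X in _ + X]big1 ?addr0 => [|z]; last first.
  by rewrite /G => /memN_msupp_eq0 ->; rewrite mul0r.
rewrite -[LHS]big_filter -[RHS]big_filter; apply: perm_big; apply: uniq_perm.
- by rewrite filter_uniq ?smonomials_uniq.
- by rewrite filter_uniq ?msupp_uniq.
move=> z; rewrite !mem_filter mem_monomials; have [zp|] := boolP (z \in _) => /=.
  by rewrite (dhomog_mf ph zp) eqxx.
by rewrite !andbF.
Qed.

End Gram.

(** * Splitting off the last variable *)

Section Extension.
Variables (n : nat) (d : 'I_n.+1 -> nat).
Hypothesis d_gt0 : forall j, (0 < d j)%N.
Local Notation d' := (dinit d).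
Implicit Types m : 'X_{1..n}.

Definition mnm_ext (a : nat) m : 'X_{1..n.+1} := (mnmwiden m + U_(ord_max) *+ a)%MM.

Lemma mnm_ext_max a m : mnm_ext a m ord_max = a.
Proof. by rewrite mnmDE mnmwiden_ordmax mulmnE mnm1E eqxx mul1n. Qed.

Lemma mnm_ext_widen a m j : mnm_ext a m (widen_ord (leqnSn n) j) = m j.
Proof.
rewrite mnmDE mnmwiden_widen mulmnE mnm1E.
by rewrite -val_eqE /= gtn_eqF ?mul0n ?addn0.
Qed.

Lemma mnm_extP a m (m1 : 'X_{1..n.+1}) :
  m1 ord_max = a -> (forall j, m1 (widen_ord (leqnSn n) j) = m j) -> m1 = mnm_ext a m.
Proof.
move=> ma mm; apply/mnmP => j; case: (unliftP ord_max j) => [j' ->|->]; last first.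
  by rewrite mnm_ext_max.
have -> : lift ord_max j' = widen_ord (leqnSn n) j'.
  by apply: val_inj; rewrite /= /bump leqNgt ltn_ord.
by rewrite mm mnm_ext_widen.
Qed.

Lemma mnm_extD a b m m' : (mnm_ext a m + mnm_ext b m')%MM = mnm_ext (a + b) (m + m')%MM.
Proof.
apply: mnm_extP => [|j]; rewrite mnmDE ?mnm_ext_max //.
by rewrite !mnm_ext_widen mnmDE.
Qed.

Lemma mnm_ext_inj a b m m' : mnm_ext a m = mnm_ext b m' -> a = b /\ m = m'.
Proof.
move=> E; split; first by rewrite -(mnm_ext_max a m) E mnm_ext_max.
by apply/mnmP => j; rewrite -(mnm_ext_widen a m) E mnm_ext_widen.
Qed.

Lemma mdeg_ext a m : mdeg (mnm_ext a m) = (mdeg m + a)%N.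
Proof.
rewrite !mdegE big_ord_recr /= mnm_ext_max; congr (_ + _)%N.
by apply: eq_bigr => j _; rewrite mnm_ext_widen.
Qed.

Lemma small_ext a m : small d (mnm_ext a m) = small d' m && (a < d ord_max)%N.
Proof.
apply/forallP/andP => [sm|[/forallP sm lt_a] j].
  split; last by have := sm ord_max; rewrite mnm_ext_max.
  by apply/forallP => j; have := sm (widen_ord (leqnSn n) j); rewrite mnm_ext_widen.
case: (unliftP ord_max j) => [j' ->|->]; last by rewrite mnm_ext_max.
have -> : lift ord_max j' = widen_ord (leqnSn n) j'.
  by apply: val_inj; rewrite /= /bump leqNgt ltn_ord.
by rewrite mnm_ext_widen; apply: sm.
Qed.

Lemma socle_ext : socle d = mnm_ext (d ord_max - 1) (socle d').
Proof. by apply: mnm_extP => [|j]; rewrite !mnmE. Qed.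

Lemma socdeg_rec : socdeg d = (socdeg d' + (d ord_max - 1))%N.
Proof. by rewrite /socdeg big_ord_recr. Qed.

Lemma mcoeff_mwiden_ext (R : comNzRingType) (p : {mpoly R[n]}) a b m :
  (mwiden p * 'X_ord_max ^+ a)@_(mnm_ext b m) = (a == b)%:R * p@_m.
Proof.
rewrite {1}(mpolyE p) !raddf_sum /= mulr_suml raddf_sum /= [in RHS](mpolyE p).
rewrite raddf_sum mulr_sumr; apply: eq_bigr => z _ /=.
rewrite mwidenZ mwidenX mpolyXn -scalerAl -mpolyXD !mcoeffZ !mcoeffX.
rewrite mulrCA -natrM mulnb; congr (_ * (_ : bool)%:R).
apply/eqP/andP => [/mnm_ext_inj[-> ->]|[/eqP-> /eqP->]] //.
Qed.

(** Expand the power of ['X_ord_max + l'], with [l'] the sum of the other variables: only the term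
    where ['X_ord_max] has exponent [d ord_max - 1 - a - b] reaches the socle, and the degree then
    forces the power of [l'] to be the one in the form for [d']. *)
Lemma gram_ext a b m m' :
    (mdeg m + a + (mdeg m' + b) <= socdeg d)%N ->
  gram d (mnm_ext a m) (mnm_ext b m') =
  binom_hankel (socdeg d - (mdeg m + a) - (mdeg m' + b)) (d ord_max) a b * gram d' m m'.
Proof.
have dn := d_gt0 ord_max.
rewrite /gram !mdeg_ext mnm_extD socle_ext; set t := (_ - _ - _)%N => le_e.
have -> : sumX int n.+1 = 'X_ord_max + mwiden (sumX int n).
  rewrite /sumX big_ord_recr addrC raddf_sum /=; congr (_ + _).
  by apply: eq_bigr => j _; rewrite mwidenX mnmwiden1.
rewrite addrC exprDn mulr_suml raddf_sum /=.
have -> : 'X_[mnm_ext (a + b) (m + m')] =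
    mwiden 'X_[m + m'] * 'X_ord_max ^+ (a + b) :> {mpoly int[n.+1]}.
  by rewrite mwidenX mpolyXn -mpolyXD.
pose c s := (sumX int n ^+ (t - s) * 'X_[m + m'])@_(socle d').
transitivity (\sum_(s < t.+1) (s + (a + b) == d ord_max - 1)%N%:R * c s *+ 'C(t, s)).
  apply: eq_bigr => s _; rewrite [X in X@__]mulrnAl mcoeffMn; congr (_ *+ _).
  by rewrite -rmorphXn mulrACA -rmorphM -exprD mcoeff_mwiden_ext.
have [le_d|lt_d] := leqP (d ord_max) (a + b).
  rewrite binom_hankel0 ?le_d // mul0r big1 // => s _.
  by rewrite (_ : (_ == _) = false) ?mul0r ?mul0rn //; lia.
have deg := socdeg_rec.
have [lt_t|le_t] := ltnP t (d ord_max - 1 - a - b).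
  rewrite binom_hankelE // bin_small // mul0r big1 // => s _.
  by rewrite (_ : (_ == _) = false) ?mul0r ?mul0rn //; have := ltn_ord s; lia.
have lt_s : (d ord_max - 1 - a - b < t.+1)%N by [].
rewrite binom_hankelE // (bigD1 (Ordinal lt_s)) //= big1 ?addr0 => [|s ne_s].
  rewrite (_ : (_ == _)) ?mul1r; last by lia.
  rewrite -mulr_natl natz; congr (_ * _@__); congr (_ ^+ _ * _); lia.
rewrite (_ : (_ == _) = false) ?mul0r ?mul0rn //.
by apply/negP => /eqP E; case/eqP: ne_s; apply: val_inj => /=; lia.
Qed.

End Extension.

(** * Block elimination along the powers of the last variable *)

Definition gram_det n (d : 'I_n -> nat) i : int := ldet 0%MM (smonomials d i) (gram d).

(* The values of hilb, which do not depend on the base field. *)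
Definition hilbert n (d : 'I_n -> nat) (j : int) : nat :=
  if j is Posz m then size (smonomials d m) else 0.

Section Recursion.
Variables (n : nat) (d : 'I_n.+1 -> nat).
Hypothesis d_gt0 : forall j, (0 < d j)%N.
Variable i : nat.
Hypothesis le_2i : (i.*2 <= socdeg d)%N.
Local Notation d' := (dinit d).
Local Notation dn := (d ord_max).
Local Notation t := (socdeg d - i.*2)%N.
Local Notation Q := (binom_hankel t dn).
Local Notation q := (hankel_minor t dn).
Let d'_gt0 : forall j, (0 < d' j)%N := dinit_gt0 d_gt0.
Let deg_rec := socdeg_rec d.
Let dn_gt0 : (0 < dn)%N := d_gt0 ord_max.

(* (m, c) stands for the monomial m x_n^c of degree i. *)
Definition levels N : seq ('X_{1..n} * nat) :=
  [seq (m, c) | c <- iota 0 N, m <- smonomials d' (i - c)].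

Definition level_gram (x y : 'X_{1..n} * nat) : rat :=
  (Q x.2 y.2)%:~R * (gram d' x.1 y.1)%:~R.

Definition level_det N : rat := ldet (0%MM, 0%N) (levels N) level_gram.

Lemma mem_levels N x :
  (x \in levels N) = [&& small d' x.1, mdeg x.1 == (i - x.2)%N & (x.2 < N)%N].
Proof.
case: x => m c /=; apply/allpairsPdep/and3P => [[c' [m' []]]|[sm mc lt_c]].
  by rewrite mem_iota mem_smonomials => lt_c /andP[sm mc] [-> ->].
by exists c, m; rewrite mem_iota mem_smonomials sm mc.
Qed.

Lemma levels_uniq N : uniq (levels N).
Proof.
apply: allpairs_uniq_dep => [|c _|]; first exact: iota_uniq.
  exact: smonomials_uniq.
by move=> [c m] [c' m'] _ _ [/= -> ->].
Qed.

Lemma levelsS N : levels N.+1 = levels N ++ [seq (m, N) | m <- smonomials d' (i - N)].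
Proof. by rewrite /levels -addn1 iotaD allpairs_cat /= cats0. Qed.

Lemma perm_smonomials_levels :
  perm_eq (smonomials d i) [seq mnm_ext x.2 x.1 | x <- levels (minn i.+1 dn)].
Proof.
apply: uniq_perm; first exact: smonomials_uniq.
  rewrite map_inj_uniq ?levels_uniq // => -[m c] [m' c'] /= /mnm_ext_inj[-> ->] //.
move=> m; rewrite mem_smonomials; apply/andP/mapP => [[sm /eqP mi]|[[m' c]]].
  pose m' : 'X_{1..n} := [multinom m (widen_ord (leqnSn n) j) | j < n].
  have mE : m = mnm_ext (m ord_max) m' by apply: mnm_extP => // j; rewrite mnmE.
  exists (m', m ord_max) => //; rewrite mem_levels /=.
  move: sm mi; rewrite {1 2}mE small_ext mdeg_ext => /andP[-> lt_c] mi.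
  by apply/and3P; split=> //; lia.
rewrite mem_levels /= => /and3P[sm /eqP mc lt_c] ->.
by rewrite small_ext mdeg_ext sm mc; split; lia.
Qed.

Lemma gram_det_levels : (gram_det d i)%:~R = level_det (minn i.+1 dn).
Proof.
rewrite /gram_det (ldet_perm _ _ perm_smonomials_levels).
rewrite (ldet_map (0%MM, 0%N)) (rmorph_ldet _ intr); apply: eq_ldet => -[m c] [m' c'].
rewrite !mem_levels /= => /and3P[sm /eqP mc lt_c] /and3P[sm' /eqP mc' lt_c'].
rewrite gram_ext //; last by rewrite mc mc'; lia.
rewrite intrM /level_gram /=; congr ((binom_hankel _ _ _ _)%:~R * _).
by rewrite mc mc'; lia.
Qed.

(** For [t < dn] and [w = dn - t - 1], the binomial is 0 if [c + c' < w] and 1 if [c + c' = w]; in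
    the latter case the degrees [i - c] and [i - c'] add up to [socdeg d'], where complements are
    dual bases. Otherwise there are no levels. *)
Lemma norm_level_det_bottom : `|level_det (minn (dn - t) i.+1)| = 1.
Proof.
pose w := (dn - t - 1)%N; pose co m := (socle d' - m)%MM.
apply: (@norm_ldet_antitrig _ _ _ _ _ (fun x => (co x.1, (w - x.2)%N)) snd).
- exact: levels_uniq.
- move=> [m c]; rewrite !mem_levels /= => /and3P[sm /eqP mc lt_c].
  (* The bound [i - c <= socdeg d'] gives [w - c <= i], so the mirrored level is in range. *)
  have := mdeg_small sm.
  by rewrite small_compl // mdeg_compl // mc /w; lia.
- move=> [m c]; rewrite !mem_levels /= => /and3P[sm /eqP mc lt_c].
  by rewrite /co complK //; congr (_, _); rewrite /w; lia.
- move=> [m c]; rewrite !mem_levels /= => /and3P[sm mc lt_c].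
  have mS : m \in smonomials d' (i - c) by rewrite mem_smonomials sm.
  rewrite /level_gram /= (gram_compl _ mS mS) // eqxx mulr1.
  rewrite binom_hankelE; last by rewrite /w; lia.
  by rewrite (_ : (_ - _)%N = t) ?binn // /w; lia.
move=> [m c] [m' c']; rewrite !mem_levels /= => /and3P[sm mc lt_c] /and3P[sm' mc' lt_c'].
rewrite xpair_eqE leq_eqVlt => ne_m /predU1P[eq_c|lt_cc'].
  move: ne_m; rewrite eq_c eqxx andbT => /negPf ne_m; rewrite eq_c in mc.
  have mS : m \in smonomials d' (i - c') by rewrite mem_smonomials sm.
  have mS' : m' \in smonomials d' (i - c') by rewrite mem_smonomials sm'.
  by rewrite /level_gram /= (gram_compl _ mS mS') // ne_m mulr0.
by rewrite /level_gram /= binom_hankel0 ?mul0r // /w; lia.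
Qed.

(* Block row reduction: a combination of rows of Q lifts to the Lefschetz form,
   with multiplication by l^(N-c) from degree i-N to degree i-c. *)
Lemma level_gram_comb N (x : nat -> rat) m m' c' :
    (N <= i)%N -> m \in smonomials d' (i - N) -> mdeg m' = (i - c')%N -> (c' <= i)%N ->
  \sum_(z <- levels N)
    x z.2 * ((sumX int n ^+ (N - z.2) * 'X_[m])@_z.1)%:~R * level_gram z (m', c') =
  (\sum_(c <- iota 0 N) x c * (Q c c')%:~R) * (gram d' m m')%:~R.
Proof.
move=> le_N; rewrite mem_smonomials => /andP[sm /eqP mN] m'c' le_c'.
rewrite big_allpairs_dep mulr_suml; apply: eq_big_seq => c; rewrite mem_iota /= => lt_c.
(* A zero binomial kills both sides. Otherwise its index bounds give
   [(i - c) + (i - c') <= socdeg d'], the degree condition of [gram_mul_sumX]. *)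
have [Q0|Qcc'] := eqVneq (Q c c') 0.
  by rewrite Q0 mulr0 mul0r big1 // => z _; rewrite /level_gram /= Q0 mul0r mulr0.
have Qle : (c + c' < dn)%N && (dn <= c + c' + t + 1)%N.
  by apply: contraNT Qcc' => /negPf H; rewrite binom_hankel0 //; lia.
rewrite -(@gram_mul_sumX _ _ d'_gt0 (N - c) (i - c)); [|lia|lia].
rewrite rmorph_sum mulr_sumr; apply: eq_bigr => z _.
by rewrite /level_gram /= intrM; ring.
Qed.

(** The Schur complement of the new level is the form for [d'] in degree [i - N], scaled by the
    pivot of [hankel_minorS], which comes out of the determinant once per basis monomial. *)
Lemma level_detS N : (N <= i)%N -> q N != 0 ->
  level_det N.+1 = level_det N *
    ((q N.+1)%:~R / (q N)%:~R) ^+ size (smonomials d' (i - N)) *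
    (gram_det d' (i - N))%:~R.
Proof.
move=> le_N qN; have [x xQ xq] := hankel_minorS qN.
pose r (u z : 'X_{1..n} * nat) : rat :=
  x z.2 * ((sumX int n ^+ (N - z.2) * 'X_[u.1])@_z.1)%:~R.
have mem_last u : u \in [seq (m, N) | m <- smonomials d' (i - N)] ->
    [/\ u.1 \in smonomials d' (i - N), mdeg u.1 = (i - N)%N & u.2 = N].
  case/mapP=> m mS ->; split=> //.
  by move: mS; rewrite mem_smonomials => /andP[_ /eqP].
rewrite /level_det levelsS (@ldet_cat _ _ _ _ _ _ r); last first.
  move=> u [m' c'] /mem_last[uS ud uN].
  rewrite mem_levels /= => /and3P[_ /eqP m'c' lt_c'].
  rewrite level_gram_comb //; last by lia.
  by rewrite -xQ // /level_gram uN.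
rewrite -mulrA; congr (_ * _).
have qE : (q N.+1)%:~R / (q N)%:~R =
    (Q N N)%:~R - \sum_(c <- iota 0 N) x c * (Q c N)%:~R :> rat.
  by rewrite -xq mulrC mulKf // intr_eq0.
rewrite qE /gram_det (rmorph_ldet _ intr) -ldetZ (@ldet_map _ _ 0%MM).
apply: eq_ldet => m m' mS; rewrite mem_smonomials => /andP[_ /eqP m'd].
by rewrite /r level_gram_comb //= /level_gram /= -mulrBl.
Qed.

Local Notation H c := (hilbert d' (i%:Z - c%:Z)).

(** Induction from [N = dn - t]: smaller nonempty minors have a zero first row, so the elimination
    cannot start earlier. The factor [|q N| ^+ H N] is the part of the last numerator that the
    denominator of the next pivot cancels. *)
Lemma norm_level_det N : (dn - t <= N)%N -> (N <= minn i.+1 dn)%N ->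
  `|level_det N| =
    (\prod_(dn - t <= c < N) `|gram_det d' (i - c)|%:~R) *
    (\prod_(dn - t <= c < N) `|q c.+1|%:~R ^ ((H c)%:Z - (H c.+1)%:Z)) *
    `|q N|%:~R ^+ H N.
Proof.
elim: N => [|N IH]; rewrite leq_eqVlt => /predU1P[<- le_c0|] //;
  try by rewrite !big_geq // mul1r mul1r norm_hankel_minor_bottom expr1n
    -norm_level_det_bottom (minn_idPl _) //; lia.
rewrite ltnS => le_c0 lt_N.
have q_neq0 c : (N <= c)%N -> (c <= N.+1)%N -> `|q c|%:~R != 0 :> rat.
  by move=> le1 le2; rewrite intr_eq0 normr_eq0 hankel_minor_neq0 //; lia.
rewrite level_detS; [|lia|by have := q_neq0 N; rewrite intr_eq0 normr_eq0; apply].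
rewrite !normrM IH //; last by lia.
rewrite normrX normf_div -!intr_norm !big_nat_recr //=.
have -> : size (smonomials d' (i - N)) = H N.
  by rewrite (_ : i%:Z - N%:Z = (i - N)%N) //; lia.
have q0 := q_neq0 N (leqnn N) (leqnSn N); have q1 := q_neq0 N.+1 (leqnSn N) (leqnn _).
set a := `|q N|%:~R in q0 *; set b := `|q N.+1|%:~R in q1 *; set g := `|gram_det _ _|%:~R.
(* Splits the power of the new minor into its final exponent and the part kept for the next
   pivot. *)
have bE : b ^+ H N = b ^ ((H N)%:Z - (H N.+1)%:Z) * b ^+ H N.+1.
  by rewrite [X in _ * X]exprnP -expfzDr // subrK -exprnP.
rewrite -[_ * a ^+ _ * _]mulrA -exprMn [a * _]mulrC divfK // bE.
by move: (b ^+ _) (b ^ _) => u v; ring.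
Qed.

(** This is [norm_level_det] at the last level, with the minors of absolute value 1 removed. *)
Theorem norm_gram_det :
  `|gram_det d i|%:~R =
    (\prod_(maxn 0 (dn - t) <= j < (minn i (dn - 1)).+1) `|gram_det d' (i - j)|%:~R) *
    (\prod_(maxn 1 (dn - i - 1) <= s < (minn (t - 1) (dn - 1)).+1)
      `|\det (Cmx t s dn)|%:~R ^
        ((hilbert d' (i%:Z + s%:Z - (dn%:Z - 1)))%:Z -
         (hilbert d' (i%:Z + s%:Z - dn%:Z))%:Z)) :> rat.
Proof.
rewrite intr_norm gram_det_levels max0n (_ : (minn i (dn - 1)).+1 = minn i.+1 dn); last by lia.
have -> : \prod_(maxn 1 (dn - i - 1) <= s < (minn (t - 1) (dn - 1)).+1)
      `|\det (Cmx t s dn)|%:~R ^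
        ((hilbert d' (i%:Z + s%:Z - (dn%:Z - 1)))%:Z -
         (hilbert d' (i%:Z + s%:Z - dn%:Z))%:Z) =
    \prod_(dn - t <= c < minn i.+1 (dn - 1))
       `|q c.+1|%:~R ^ ((H c)%:Z - (H c.+1)%:Z) :> rat.
  (* [Cmx t s dn] has size [dn - s], so [s] corresponds to level [dn - 1 - s]; level [dn - 1], which
     would be [s = 0], is left out. *)
  pose rev s := (dn - 1 - s)%N.
  rewrite (perm_big [seq rev c | c <- index_iota (dn - t) (minn i.+1 (dn - 1))]) /=.
    rewrite big_map; apply: eq_big_seq => c; rewrite mem_index_iota => lt_c.
    rewrite det_Cmx (_ : (dn - rev c)%N = c.+1); last by rewrite /rev; lia.
    rewrite (_ : i%:Z + (rev c)%:Z - (dn%:Z - 1) = i%:Z - c%:Z); last by rewrite /rev; lia.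
    by rewrite (_ : i%:Z + (rev c)%:Z - dn%:Z = i%:Z - c.+1%:Z) //; rewrite /rev; lia.
  apply: uniq_perm; first exact: iota_uniq.
    rewrite map_inj_in_uniq ?iota_uniq // => c c'; rewrite !mem_index_iota /rev; lia.
  move=> s; rewrite mem_index_iota; apply/idP/mapP => [le_s|[c + ->]].
    by exists (rev s); rewrite ?mem_index_iota /rev; lia.
  by rewrite mem_index_iota /rev; lia.
(* If [i + 1 < dn - t], all levels lie in the antitriangular part and both products are empty. *)
have [lt_M|le_M] := ltnP (minn i.+1 dn) (dn - t).
  rewrite !big_geq; [|lia|lia].
  by rewrite mulr1 -norm_level_det_bottom; congr `|level_det _|; lia.
rewrite norm_level_det // -mulrA; congr (_ * _).
(* The leftover power of [q] is trivial: for [i < dn - 1] its exponent is the Hilbert function in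
   degree -1, and otherwise the minor is the full one. *)
have [lt_i|le_i] := ltnP i (dn - 1).
  rewrite (_ : minn i.+1 (dn - 1) = minn i.+1 dn); last by lia.
  rewrite (_ : i%:Z - (minn i.+1 dn)%:Z = Negz 0) ?mulr1 //; lia.
rewrite (_ : minn i.+1 dn = dn); last by lia.
rewrite (_ : minn i.+1 (dn - 1) = (dn - 1)%N); last by lia.
rewrite norm_hankel_minor_top expr1n mulr1.
(* Level [dn - 1] contributes the full minor, of absolute value 1; for [t = 0] both ranges are
   empty. *)
have [lt_c|ge_c] := ltnP (dn - t) dn; last by rewrite !big_geq //; lia.
have dnE : dn = (dn - 1).+1 by lia.
rewrite [X in index_iota _ X]dnE big_nat_recr /=; last by lia.
by rewrite -[in q _]dnE norm_hankel_minor_top exp1rz mulr1.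
Qed.

End Recursion.

(** Induction on the number of variables: [j >= d_n - t] puts degree [i - j] in the lower half of
    the smaller algebra, and [s < t] puts the minor of size [d_n - s] within the range of
    [hankel_minor_neq0]. *)
Lemma gram_det_neq0 n (d : 'I_n -> nat) i :
  (forall j, 0 < d j)%N -> (i.*2 <= socdeg d)%N -> gram_det d i != 0.
Proof.
elim: n d i => [|n IH] d i d_gt0 le_2i.
  have all_eq (x y : 'X_{1..0}) : x = y by apply/mnmP => -[].
  rewrite /gram_det (@ldet_utrig _ _ _ _ _ (fun=> 0%N)) ?oner_eq0 ?smonomials_uniq //.
    move=> x _; rewrite /gram /socdeg big_ord0 expr0 mul1r mcoeffX.
    by case: eqP => // -[]; apply: all_eq.
  by move=> x y _ _ /eqP[]; apply: all_eq.
have deg_rec := socdeg_rec d; have dn_gt0 := d_gt0 ord_max.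
rewrite -normr_eq0 -(intr_eq0 rat) norm_gram_det // mulf_neq0 //.
  rewrite prodf_seq_neq0; apply/allP => j; rewrite mem_index_iota => lt_j /=.
  by rewrite intr_eq0 normr_eq0 IH //; [move=> ?; apply: d_gt0 | lia].
rewrite prodf_seq_neq0; apply/allP => s; rewrite mem_index_iota => lt_s /=.
by rewrite expfz_neq0 // intr_eq0 normr_eq0 det_Cmx hankel_minor_neq0 //; lia.
Qed.

(** * Multiplication maps and the strong Lefschetz property *)

Section Lefschetz.
Variables (k : fieldType) (n : nat) (d : 'I_n -> nat).
Hypothesis d_gt0 : forall j, (0 < d j)%N.
Local Notation basis := (mci_basis k d_gt0).
Local Notation mcl := (@mcl k n d d_gt0).

Lemma size_basis i : size (basis i) = size (smonomials d i).
Proof. by rewrite mci_basisE size_map. Qed.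

Lemma nth_basis i r : (r < size (smonomials d i))%N ->
  (basis i)`_r = mcl 'X_[nth 0%MM (smonomials d i) r].
Proof. by move=> lt_r; rewrite mci_basisE (nth_map 0%MM). Qed.

Lemma hilbE j : hilb k d_gt0 j = hilbert d j.
Proof.
case: j => //= i; have /andP[/eqP <- /eqP ->] := mci_basisP k d_gt0 i.
exact: size_basis.
Qed.

Lemma mci_ellE : mci_ell k d_gt0 = mcl (sumX k n).
Proof. by rewrite /sumX rmorph_sum. Qed.

Lemma lef_mult_comp t i x : x \in mci_comp k d_gt0 i ->
  mci_ell k d_gt0 ^+ t * x \in mci_comp k d_gt0 (i + t).
Proof.
case/mci_compP=> p ph ->; apply/mci_compP; exists (sumX k n ^+ t * p).
  by rewrite addnC; apply: dhomogM; rewrite ?sumX_homog.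
by rewrite mci_ellE rmorphM rmorphXn.
Qed.

Lemma lef_mx_coef i t r c :
  lef_mx k d_gt0 i t r c =
  ((sumX int n ^+ t * 'X_[nth 0%MM (smonomials d i) r])
     @_(nth 0%MM (smonomials d (i + t)) c))%:~R.
Proof.
have lt j (l : 'I_(size (basis j))) : (l < size (smonomials d j))%N by rewrite -size_basis.
have sc : small d (nth 0%MM (smonomials d (i + t)) c).
  by have := mem_nth 0%MM (lt _ c); rewrite mem_smonomials => /andP[].
have := lef_mxP t r; rewrite nth_basis // mci_ellE -rmorphXn -rmorphM.
under eq_bigr => c' _ do rewrite nth_basis // -linearZ.
rewrite -raddf_sum => /(congr1 (mcoef (nth 0%MM (smonomials d (i + t)) c))).
rewrite !mcoef_mcl // raddf_sum (bigD1 c) //= big1 ?addr0 => [|c' ne_c]; last first.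
  rewrite mcoeffZ mcoeffX nth_uniq ?smonomials_uniq //.
  by rewrite (inj_eq val_inj) (negPf ne_c) mulr0.
rewrite mcoeffZ mcoeffX eqxx mulr1 => <-.
rewrite -mcoeff_map_mpoly rmorphM rmorphXn /= map_mpolyX; congr ((_ ^+ _ * _)@__).
by rewrite [RHS]rmorph_sum; apply: eq_bigr => j _; rewrite /= map_mpolyX.
Qed.

Lemma det_conform_mx a b (M : 'M[k]_(a, b)) (f : nat -> nat -> k) : b = a ->
    (forall r c, M r c = f r c) ->
  \det (conform_mx (0 : 'M_a) M) = \det (\matrix_(r < a, c < a) f r c).
Proof.
move=> ba; move: M; rewrite ba => M Mf; rewrite conform_mx_id.
by congr (\det _); apply/matrixP => r c; rewrite mxE.
Qed.

(** Complementing the target monomials turns the multiplication matrix into the Gram matrix; the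
    order of the complements affects only the sign. *)
Lemma lef_det_gram i : (i.*2 <= socdeg d)%N ->
  exists b : bool, lef_det k d_gt0 i (socdeg d - i.*2) = (-1) ^+ b * (gram_det d i)%:~R.
Proof.
move=> le_2i; set t := (_ - _)%N.
have it : (i + t = socdeg d - i)%N by rewrite /t; lia.
pose f m m' : int := (sumX int n ^+ t * 'X_[m])@_m'.
pose s := smonomials d i; pose s' := smonomials d (i + t).
rewrite /lef_det (@det_conform_mx _ _ _ (fun r c => (f (nth 0%MM s r) (nth 0%MM s' c))%:~R)).
- rewrite size_basis.
  have ss' : perm_eq s [seq (socle d - m)%MM | m <- s'].
    have := smonomials_compl d_gt0 (leq_subr i (socdeg d)).
    by rewrite /s' it subKn //; lia.
  have [b detE] := det_perm_col 0%MM (gram d) ss'; exists b.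
  rewrite -[gram_det d i]/(ldet _ s _) -(rmorph_sign intr) -rmorphM -detE -det_map_mx.
  congr (\det _); apply/matrixP => r c; rewrite !mxE; congr _%:~R.
  have sz : size s = size s' by rewrite (perm_size ss') size_map.
  have lt_c : (c < size s')%N by rewrite -sz.
  have := mem_nth 0%MM (ltn_ord r); have := mem_nth 0%MM lt_c.
  rewrite !mem_smonomials (nth_map 0%MM) // => /andP[sc /eqP cd] /andP[sr /eqP rd].
  rewrite -(@gram_coef _ _ d_gt0 t) ?complK ?small_compl ?mdeg_compl //.
  by rewrite rd cd; lia.
- exact: lef_mx_square.
- exact: lef_mx_coef.
Qed.

Hypothesis k_char0 : [pchar k] =i pred0.

Lemma lef_absdet_gram i : (i.*2 <= socdeg d)%N ->
  lef_absdet k d_gt0 i = `|gram_det d i|%N.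
Proof.
move=> le_2i; apply/eqP/(lef_absdetP _ _ _ k_char0).
have [b ->] := lef_det_gram le_2i.
have [->|->] : (gram_det d i)%:~R = `|gram_det d i|%N%:R :> k \/
    (gram_det d i)%:~R = - `|gram_det d i|%N%:R :> k.
- by case: (gram_det d i) => N; [left | right; rewrite NegzE rmorphN].
- by case: b; rewrite ?mulN1r ?mul1r; [right | left].
by case: b; rewrite ?mulN1r ?mul1r ?opprK; [left | right].
Qed.

Lemma conform_mx_inj a b (M : 'M[k]_(a, b)) (u : 'rV_a) : b = a ->
  \det (conform_mx (0 : 'M_a) M) != 0 -> u *m M = 0 -> u = 0.
Proof.
move=> ba; move: M; rewrite ba => M; rewrite conform_mx_id => M0 uM.
have Mu : M \in unitmx by rewrite unitmxE unitfE.
by rewrite -(mulmxK Mu u) uM mul0mx.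
Qed.

Lemma lef_mult_inj i x : (i.*2 <= socdeg d)%N -> x \in mci_comp k d_gt0 i ->
  mci_ell k d_gt0 ^+ (socdeg d - i.*2) * x = 0 -> x = 0.
Proof.
move=> le_2i xi; set t := (_ - _)%N => lx.
have /andP[_ free_t] := mci_basisP k d_gt0 (i + t).
pose u := \row_r coord (in_tuple (basis i)) r x.
have xE : x = \sum_r u 0 r *: (basis i)`_r.
  rewrite {1}(coord_basis (mci_basisP k d_gt0 i : basis_of _ (in_tuple _)) xi).
  by apply: eq_bigr => r _; rewrite mxE.
suff u0 : u = 0 by rewrite xE big1 // => r _; rewrite u0 mxE scale0r.
apply: (@conform_mx_inj _ _ (lef_mx k d_gt0 i t)); first exact: lef_mx_square.
  have [b detE] := lef_det_gram le_2i.
  rewrite -/(lef_det k d_gt0 i t) detE mulf_neq0 ?signr_eq0 //.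
  have := gram_det_neq0 d_gt0 le_2i; have /pcharf0P k0 := k_char0.
  by case: (gram_det d i) => N; rewrite ?NegzE ?rmorphN ?oppr_eq0 /= k0.
apply/rowP => c; rewrite [RHS]mxE.
apply: (@freeP _ _ _ (in_tuple (basis (i + t))) free_t
  (fun c => (u *m lef_mx k d_gt0 i t) 0 c)).
rewrite -[RHS]lx [in RHS]xE mulr_sumr.
under [RHS]eq_bigr => r _ do rewrite -scalerAr lef_mxP scaler_sumr.
rewrite exchange_big /=; apply: eq_bigr => c' _; rewrite mxE scaler_suml.
by apply: eq_bigr => r _; rewrite scalerA.
Qed.

(** Injectivity between spaces of equal dimension. *)
Lemma lef_mult_surj i y : (i.*2 <= socdeg d)%N -> y \in mci_comp k d_gt0 (socdeg d - i) ->
  exists2 x, x \in mci_comp k d_gt0 i & mci_ell k d_gt0 ^+ (socdeg d - i.*2) * x = y.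
Proof.
move=> le_2i; set t := (_ - i.*2)%N.
have it : (socdeg d - i = i + t)%N by rewrite /t; lia.
pose phi := amull (mci_ell k d_gt0 ^+ t).
suff <- : (phi @: mci_comp k d_gt0 i = mci_comp k d_gt0 (socdeg d - i))%VS.
  by case/memv_imgP=> x xi ->; exists x; rewrite // lfunE.
have size_dim j : \dim (mci_comp k d_gt0 j) = size (basis j).
  by have /andP[/eqP <- /eqP ->] := mci_basisP k d_gt0 j.
apply/eqP; rewrite eqEdim; apply/andP; split.
  by apply/subvP => _ /memv_imgP[x xi ->]; rewrite lfunE /= it lef_mult_comp.
rewrite limg_dim_eq; first by rewrite !size_dim size_mci_basis //; lia.
apply/eqP; rewrite -subv0; apply/subvP => x; rewrite memv_cap memv_ker lfunE /=.
by case/andP=> xi /eqP /(lef_mult_inj le_2i xi) ->; apply: mem0v.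
Qed.

(** For [2 i + t <= e], [l^t] is the first factor of the injective [l^(e - 2 i)]. For
    [i + t <= e < 2 i + t] and [u = e - (i + t)], the surjection [l^(e - 2 u)] onto degree [i + t]
    factors through degree [i]. Beyond [e] the target is zero. *)
Lemma mci_strong_Lefschetz : strong_Lefschetz (mci_comp k d_gt0).
Proof.
exists (mci_ell k d_gt0) => [|i t t_gt0].
  rewrite mci_ellE; apply/mci_compP; exists (sumX k n) => //.
  by rewrite -[sumX _ _]expr1 sumX_homog.
have [le_e|gt_e] := leqP (i.*2 + t) (socdeg d).
  left=> x y xi yi /= eq_xy; apply/eqP; rewrite -subr_eq0.
  apply/eqP/(@lef_mult_inj i); [lia | exact: rpredB |].
  rewrite (_ : (socdeg d - i.*2)%N = (socdeg d - i.*2 - t + t)%N); last by lia.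
  by rewrite exprD -mulrA mulrBr eq_xy subrr mulr0.
right=> y; have [le_it yit|gt_it] := leqP (i + t) (socdeg d).
  have [||x xu <-] := @lef_mult_surj (socdeg d - (i + t)) y; [lia | by rewrite subKn |].
  set u := (socdeg d - (i + t))%N in xu *.
  exists (mci_ell k d_gt0 ^+ (i - u) * x).
    by rewrite -[X in mci_comp _ _ X](subnKC (_ : (u <= i)%N)) ?lef_mult_comp // /u; lia.
  by rewrite mulrA -exprD; congr (_ ^+ _ * _); rewrite /u; lia.
move=> yit; exists 0; first exact: mem0v.
have := hilb_gt k d_gt0 (j := (i + t)%N); rewrite ltz_nat => /(_ gt_it) /eqP.
by rewrite dimv_eq0 => /eqP E; move: yit; rewrite E memv0 mulr0 eq_sym => /eqP.
Qed.

End Lefschetz.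

Theorem theorem4p1 (k : fieldType) (k_char0 : [pchar k] =i pred0) (n : nat)
    (d : 'I_n.+1 -> nat) (d_gt0 : forall j, (0 < d j)%N) :
  (forall i : nat, (i.*2 <= socdeg d)%N ->
    let t := (socdeg d - i.*2)%N in
    let dn := d ord_max in
    let a' := lef_absdet k (dinit_gt0 d_gt0) in
    let h := hilb k (dinit_gt0 d_gt0) in
    (lef_absdet k d_gt0 i)%:R
      = (\prod_(maxn 0 (dn - t) <= j < (minn i (dn - 1)).+1) (a' (i - j)%N)%:R)
        * \prod_(maxn 1 (dn - i - 1) <= s < (minn (t - 1) (dn - 1)).+1)
            (`|\det (Cmx t s dn)|%:~R)
              ^ ((h (i%:Z + s%:Z - (dn%:Z - 1)))%:Z
                 - (h (i%:Z + s%:Z - dn%:Z))%:Z)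
      :> rat
    /\ lef_absdet k d_gt0 i != 0%N)
  /\ strong_Lefschetz (mci_comp k d_gt0).
Proof.
split=> [i le_2i t dn a' h|]; last exact: mci_strong_Lefschetz.
have deg := socdeg_rec d; have dn_gt0 : (0 < dn)%N := d_gt0 ord_max.
rewrite lef_absdet_gram // absz_eq0 gram_det_neq0 //; split=> //.
rewrite natr_absz norm_gram_det //; congr (_ * _).
  apply: eq_big_nat => j le_j.
  by rewrite /a' lef_absdet_gram ?natr_absz //; rewrite /dn /t in le_j; lia.
by apply: eq_bigr => s _; rewrite /h !hilbE.
Qed.
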